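(* Let $n, M$ be positive integers, let $\mathcal M=\{(m_1,\dots,m_n)\in\mathbb Z^n : m_j\ge 0,\ \sum_{j=1}^n m_j=M\}$, and let $\psi:\mathcal M\to\mathbb R_{\ge 0}$, $\psi(\mathbf m)=\sum_{j=1}^n\varphi_j(m_j)$, be a decomposable error function with associated difference functions $H_j(\ell)=\varphi_j(\ell)-\varphi_j(\ell-1)$ for integers $\ell\ge 1$. Call $\mathbf m\in\mathcal M$ a minimal solution if $\psi(\mathbf m)\le\psi(\mathbf m')$ for all $\mathbf m'\in\mathcal M$. Then: 1. There is at least one minimal solution. 2. A vector $\mathbf m^0=(m_1^0,\dots,m_n^0)\in\mathcal M$ is a minimal solution if and only if $H_j(m_j^0+1)\ge H_k(m_k^0)$ for all $j,k\in\{1,\dots,n\}$ with $m_k^0\ge 1$. 3. A minimal solution $\mathbf m^0$ is the unique minimal solution if $H_j(m_j^0+1)> H_k(m_k^0)$ for all $j,k\in\{1,\dots,n\}$ with $j\ne k$ and $m_k^0\ge 1$. 4. Let $\mathcal S$ be the set of vectors $\mathbf m=(m_1,\dots,m_n)$ of non-negative integers such that (a) $\sum_{j=1}^n m_j=M$, and (b) the multiset $\{H_j(\ell) : 1\le \ell\le m_j,\ 1\le j\le n\}$ (which has $M$ elements, counted with multiplicity) is the multiset of the $M$ smallest entries, counted with multiplicity, of the $M\times n$ matrix whose entry in row $\ell$ and column $j$ is $H_j(\ell)$. Then $\mathcal S$ is exactly the set of all minimal solutions.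
   Context: Here $\mathbb N=\{0,1,2,\dots\}$ and $\mathbb N^+=\{1,2,\dots\}$. Decomposable error function: for $1\le j\le n$ let $\varphi_j:\mathbb N\to\mathbb R_{\ge 0}$ be functions such that each function $H_j:\mathbb N^+\to\mathbb R$, $H_j(\ell)=\varphi_j(\ell)-\varphi_j(\ell-1)$, is increasing in the weak sense, i.e. $H_j(\ell)\le H_j(\ell+1)$ for all $\ell\ge 1$. Then $\psi:\mathcal M\to\mathbb R_{\ge 0}$, $\psi(\mathbf m)=\sum_{j=1}^n\varphi_j(m_j)$, is called a decomposable error function, with $j$-th component $\varphi_j$. *)

(* Defs.v *)
From HB Require Import structures.
From mathcomp Require Import all_boot all_order all_algebra.
From mathcomp Require Import reals.

Set Implicit Arguments.
Unset Strict Implicit.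
Unset Printing Implicit Defensive.

Import Order.TTheory GRing.Theory Num.Theory.
Local Open Scope ring_scope.

Section Decomposable.
Variables (R : realType) (n : nat).
Implicit Types (phi : 'I_n -> nat -> R) (psi : {ffun 'I_n -> nat} -> R).
Implicit Types (m : {ffun 'I_n -> nat}) (M : nat).

Definition feasible M m : Prop := (\sum_(j < n) m j)%N = M.

(* Only meaningful for 1 <= l: at l = 0 the truncated predecessor makes it 0. *)
Definition H phi (j : 'I_n) (l : nat) : R := phi j l - phi j l.-1.

(* The domain of psi is the set of feasible vectors: its values elsewhere are
   left unconstrained. *)
Definition decomposable_error M phi psi : Prop :=
  [/\ forall j l, 0 <= phi j l,
      forall j l, (1 <= l)%N -> H phi j l <= H phi j l.+1
    & forall m, feasible M m -> psi m = \sum_(j < n) phi j (m j)].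

Definition minimal_solution M psi m : Prop :=
  feasible M m /\ forall m', feasible M m' -> psi m <= psi m'.

(* Ordinals start at 0, so the row of H_j(l) has index l - 1. *)
Definition H_matrix M phi : 'M[R]_(M, n) :=
  \matrix_(l < M, j < n) H phi j l.+1.

(* Multisets are represented by sequences up to perm_eq. *)
Definition mx_entries M (A : 'M[R]_(M, n)) : seq R :=
  [seq A l j | l <- enum 'I_M, j <- enum 'I_n].

Definition smallest (k : nat) (s : seq R) : seq R := take k (sort <=%R s).

Definition selected phi m : seq R :=
  [seq H phi j l | j <- enum 'I_n, l <- iota 1 (m j)].

Definition greedy_selection M phi m : Prop :=
  feasible M m /\
  perm_eq (selected phi m) (smallest M (mx_entries (H_matrix M phi))).

End Decomposable.

(* Main.v *)
(** A decomposable error function is a sum of one-variable convex functions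
    under the constraint that the variables add up to [M]. If no increment
    [H_k(m_k)] exceeds some [H_j(m_j + 1)], then there is a number [c] between
    all the former and all the latter; it is a common slope of supporting lines
    of the [phi_j] at [m_j], and the sum of these lines is constant on feasible
    vectors, so [m] is minimal. Conversely, moving one unit from [k] to [j]
    changes the error by [H_j(m_j + 1) - H_k(m_k)].

    The same inequalities say that every selected increment is at most every
    unselected one, so a minimal solution selects the [M] smallest entries.
    Since the error is a constant plus the sum of the selected increments, any
    other greedy selection has the same error. *)
Require Import Defs.
From HB Require Import structures.
From mathcomp Require Import all_boot all_order all_algebra.
From mathcomp Require Import reals.

Set Implicit Arguments.
Unset Strict Implicit.
Unset Printing Implicit Defensive.

Import Order.TTheory GRing.Theory Num.Theory.
Local Open Scope ring_scope.

Lemma perm_allpairsC (S T : Type) (U : eqType) (f : S -> T -> U)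
    (s : seq S) (t : seq T) :
  perm_eq [seq f x y | x <- s, y <- t] [seq f x y | y <- t, x <- s].
Proof.
elim: t => [|y t IHt]; first by rewrite allpairs0r.
by rewrite perm_allpairs_consr /= perm_cat2l.
Qed.

(** Sorting [s1] and [s2] separately and concatenating gives a sorted permutation of [s], hence
    [sort s] itself. *)
Lemma take_sort_cat (d : Order.disp_t) (T : orderType d) (s s1 s2 : seq T) :
  perm_eq s (s1 ++ s2) -> allrel <=%O s1 s2 ->
  take (size s1) (sort <=%O s) = sort <=%O s1.
Proof.
move=> s_perm le12.
suff -> : sort <=%O s = sort <=%O s1 ++ sort <=%O s2.
  by rewrite take_size_cat ?size_sort.
apply: le_sorted_eq; first exact: sort_le_sorted.
  rewrite sorted_pairwise; last exact: le_trans.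
  rewrite pairwise_cat -!sorted_pairwise ?sort_le_sorted ?andbT;
    try exact: le_trans.
  apply/allrelP => x y; rewrite !mem_sort; exact: (allrelP le12).
by rewrite perm_sort (perm_trans s_perm) // perm_cat // perm_sym perm_sort.
Qed.

Section Increments.
Variables (R : realType) (n : nat).
Implicit Types (phi : 'I_n -> nat -> R) (m : {ffun 'I_n -> nat}) (M : nat).

Definition convex_components phi :=
  forall j l, (1 <= l)%N -> H phi j l <= H phi j l.+1.

Definition total_error phi m : R := \sum_(j < n) phi j (m j).

Definition balanced phi m :=
  forall j k : 'I_n, (1 <= m k)%N -> H phi k (m k) <= H phi j (m j).+1.

Lemma le_H phi j a b :
  convex_components phi -> (1 <= a)%N -> (a <= b)%N -> H phi j a <= H phi j b.
Proof.
move=> phi_cvx; case: a => // a _; case: b => // b; rewrite ltnS.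
apply: (homo_leq (f := fun l => H phi j l.+1) (r := <=%R)) => //.
- by move=> y x z; apply: le_trans.
- by move=> l; apply: phi_cvx.
Qed.

Lemma sum_H phi j a b :
  (a <= b)%N -> \sum_(a <= l < b) H phi j l.+1 = phi j b - phi j a.
Proof. by move=> le_ab; rewrite -telescope_sumr. Qed.

(** The difference telescopes into increments: those above [a] are at least [c], those up to [a] at
    most [c]. For [a = 0] nothing lies below, and [H phi j 0] is only a default value, whence the
    guard. *)
Lemma supporting_line phi j a b (c : R) : convex_components phi ->
  ((1 <= a)%N -> H phi j a <= c) -> c <= H phi j a.+1 ->
  c * (b%:R - a%:R) <= phi j b - phi j a.
Proof.
move=> phi_cvx le_c ge_c; have [le_ab|/ltnW le_ba] := leqP a b.
  rewrite -sum_H // -natrB // mulr_natr -sumr_const_nat.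
  apply: ler_sum_nat => l /andP[le_al _]; apply: (le_trans ge_c); exact: le_H.
rewrite -lerN2 -mulrN !opprB -sum_H // -natrB // mulr_natr -sumr_const_nat.
apply: ler_sum_nat => l /andP[_ lt_la]; apply: le_trans (le_c _).
  exact: le_H.
exact: leq_ltn_trans lt_la.
Qed.

Lemma feasible_le M m j : feasible M m -> (m j <= M)%N.
Proof. by move=> <-; rewrite (bigD1 j) //= leq_addr. Qed.

Lemma balanced_separation M phi m : (0 < M)%N -> feasible M m -> balanced phi m ->
  exists2 c : R, forall k, (1 <= m k)%N -> H phi k (m k) <= c
               & forall j, c <= H phi j (m j).+1.
Proof.
move=> M_gt0 m_feas m_bal.
have [k0 k0_gt0] : exists k, (1 <= m k)%N.
  apply/existsP; apply: contraTT M_gt0 => /existsPn m0.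
  by rewrite -m_feas big1 // => k _; move: (m0 k); rewrite lt0n negbK => /eqP.
(* The slope [c] is the largest last selected increment; since [M] is positive, some column has
   one. *)
case: (@arg_maxP _ _ _ k0 (fun k => 1 <= m k)%N (fun k => H phi k (m k)) k0_gt0).
move=> k k_gt0 k_max; exists (H phi k (m k)) => [i /k_max //|j]; exact: m_bal.
Qed.

Lemma balanced_le M phi m m' : (0 < M)%N -> convex_components phi ->
  feasible M m -> balanced phi m -> feasible M m' ->
  total_error phi m <= total_error phi m'.
Proof.
move=> M_gt0 phi_cvx m_feas m_bal m'_feas.
have [c le_c ge_c] := balanced_separation M_gt0 m_feas m_bal.
rewrite -subr_ge0 -sumrB.
have lines0 : \sum_(j < n) c * ((m' j)%:R - (m j)%:R) = 0 :> R.
  by rewrite -mulr_sumr sumrB -!natr_sum m_feas m'_feas subrr mulr0.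
rewrite -[leLHS]lines0; apply: ler_sum => j _.
apply: supporting_line => //; exact: le_c.
Qed.

(** Adding before subtracting makes the case [k = j] the identity. *)
Definition transfer m (k j : 'I_n) : {ffun 'I_n -> nat} :=
  [ffun i => (m i + (i == j) - (i == k))%N].

Lemma feasible_transfer M m k j :
  (1 <= m k)%N -> feasible M m -> feasible M (transfer m k j).
Proof.
move=> k_gt0; rewrite /feasible => <-.
have sum_delta i0 : (\sum_(i < n) (i == i0) = 1)%N.
  by rewrite (bigD1 i0) //= eqxx big1 // => i /negPf->.
(* One unit is added to both sides and spread as an indicator of [k] on the left and of [j] on the
   right, so that the truncated subtraction cancels term by term. *)
apply/eqP; rewrite -(eqn_add2r 1) -{1}(sum_delta k) -(sum_delta j) -!big_split /=.
apply/eqP/eq_bigr => i _; rewrite ffunE subnK //.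
by case: eqP => // ->; rewrite (leq_trans k_gt0) ?leq_addr.
Qed.

Lemma total_error_transfer phi m k j : (1 <= m k)%N -> j != k ->
  total_error phi (transfer m k j) - total_error phi m
    = H phi j (m j).+1 - H phi k (m k).
Proof.
move=> k_gt0 jk; rewrite -sumrB (bigD1 j) // (bigD1 k) 1?eq_sym //= big1 ?addr0.
  rewrite !ffunE !eqxx (negPf jk) eq_sym (negPf jk) subn0 addn0 addn1 subn1.
  by rewrite /H /= opprB.
by move=> i /andP[ij ik]; rewrite ffunE (negPf ij) (negPf ik) addn0 subn0 subrr.
Qed.

Definition unselected M phi m : seq R :=
  [seq H phi j l | j <- enum 'I_n, l <- iota (m j).+1 (M - m j)].

(** Read by columns, the matrix is cut in column [j] after row [m j], which is at most [M] by
    feasibility. *)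
Lemma perm_mx_entries M phi m : feasible M m ->
  perm_eq (mx_entries (H_matrix M phi)) (selected phi m ++ unselected M phi m).
Proof.
move=> m_feas.
have -> : mx_entries (H_matrix M phi)
    = [seq H phi j l | l <- iota 1 M, j <- enum 'I_n].
  rewrite -[1%N]addn0 iotaDl -val_enum_ord -map_comp allpairs_mapl.
  by apply: eq_allpairs => l j /=; rewrite mxE.
rewrite (permPl (perm_allpairsC (fun l j => H phi j l) _ _)) perm_sym.
rewrite -(perm_allpairs_catr (H phi)).
apply: perm_allpairs_dep => // j _.
rewrite -[X in perm_eq _ (iota 1 X)](subnKC (feasible_le j m_feas)).
by rewrite iotaD add1n.
Qed.

Lemma size_selected M phi m : feasible M m -> size (selected phi m) = M.
Proof.
move=> <-; rewrite size_allpairs_dep sumnE big_map big_enum /=.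
by apply: eq_bigr => j _; rewrite size_iota.
Qed.

Lemma sum_selected phi m :
  \sum_(x <- selected phi m) x = total_error phi m - \sum_(j < n) phi j 0%N.
Proof.
rewrite big_allpairs_dep big_enum /= -sumrB; apply: eq_bigr => j _.
by rewrite -sum_H // -[1%N]addn0 iotaDl big_map /index_iota subn0.
Qed.

(** For [l <= m k] and [m j < l'], the chain is [H_k(l) <= H_k(m k) <= H_j(m j + 1) <= H_j(l')]. *)
Lemma balanced_allrel M phi m : convex_components phi -> balanced phi m ->
  allrel <=%R (selected phi m) (unselected M phi m).
Proof.
move=> phi_cvx m_bal; apply/allrelP => x y.
case/allpairsPdep=> k [l [_ + ->]] /allpairsPdep[j [l' [_ + ->]]].
rewrite !mem_iota add1n ltnS => /andP[l_gt0 le_l] /andP[lt_l' _].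
apply: (le_trans (le_H _ phi_cvx l_gt0 le_l)).
apply: (le_trans (m_bal j k (leq_trans l_gt0 le_l))).
exact: le_H.
Qed.

Lemma balanced_greedy M phi m : convex_components phi ->
  feasible M m -> balanced phi m -> greedy_selection M phi m.
Proof.
move=> phi_cvx m_feas m_bal; split=> //; rewrite /smallest.
rewrite -{1}(size_selected phi m_feas).
rewrite (take_sort_cat (perm_mx_entries phi m_feas)); last exact: balanced_allrel.
by rewrite perm_sym perm_sort.
Qed.

Lemma greedy_total_error M phi m m' : greedy_selection M phi m ->
  greedy_selection M phi m' -> total_error phi m = total_error phi m'.
Proof.
move=> [_ m_sel] [_ m'_sel]; apply: (addIr (- \sum_(j < n) phi j 0%N)).
rewrite -!sum_selected; apply: perm_big; apply: (perm_trans m_sel).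
by rewrite perm_sym.
Qed.

(** Coordinates of feasible vectors are at most [M], so the search takes place in a finite type; it
    starts from the vector with all [M] units in one coordinate. *)
Lemma exists_minimal_solution M (psi : {ffun 'I_n -> nat} -> R) :
  (0 < n)%N -> exists m, minimal_solution M psi m.
Proof.
move=> n_gt0; pose i0 := Ordinal n_gt0.
pose to_nat (t : {ffun 'I_n -> 'I_M.+1}) := [ffun j => t j : nat].
pose feas t := (\sum_(j < n) to_nat t j == M)%N.
pose t0 : {ffun 'I_n -> 'I_M.+1} :=
  [ffun j => if j == i0 then ord_max else ord0].
have t0_feas : feas t0.
  rewrite /feas (bigD1 i0) //= big1 => [|j /negPf j_neq0]; by
    rewrite !ffunE ?eqxx ?j_neq0 ?addn0.
case: (@arg_minP _ _ _ t0 feas (psi \o to_nat) t0_feas) => t /eqP t_feas t_min.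
exists (to_nat t); split=> // m m_feas.
have to_natK : to_nat [ffun j => inord (m j)] = m.
  by apply/ffunP => j; rewrite !ffunE inordK // ltnS (feasible_le _ m_feas).
rewrite -to_natK; apply: t_min; rewrite /feas to_natK; exact/eqP.
Qed.

Lemma minimal_solutionP M phi psi m : (0 < M)%N ->
  decomposable_error M phi psi -> feasible M m ->
  minimal_solution M psi m <-> balanced phi m.
Proof.
move=> M_gt0 [_ phi_cvx psiE] m_feas; split=> [[_ m_min] j k k_gt0|m_bal].
  (* For [j = k] no unit moves, and the inequality is convexity. *)
  have [->|jk] := eqVneq j k; first exact: phi_cvx.
  rewrite -subr_ge0 -total_error_transfer // subr_ge0 /total_error.
  by rewrite -!psiE ?m_min //; apply: feasible_transfer.
split=> // m' m'_feas; rewrite !psiE //; exact: balanced_le m'_feas.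
Qed.

(** Otherwise [m'] lies below [m] everywhere, and equal sums force equality. *)
Lemma exists_lt_feasible M m m' : feasible M m -> feasible M m' -> m != m' ->
  exists j, (m j < m' j)%N.
Proof.
move=> m_feas m'_feas neq; apply/existsP; apply: contraNT neq => /existsPn ge_m.
have le_m j : true -> (m' j <= m j ?= iff (m' j == m j))%N.
  by move=> _; split=> //; rewrite leqNgt.
have [_] := leqif_sum le_m.
rewrite m_feas m'_feas eqxx => /esym/forallP eq_m.
by apply/eqP/ffunP => j; rewrite (eqP (eq_m j)).
Qed.

(** If the vectors differ, some [k] has [m' k < m k] and some [j] has [m j < m' j]. Then [H_j(m j +
    1) <= H_j(m' j) <= H_k(m' k + 1) <= H_k(m k)], against strictness. *)
Lemma strictly_balanced_uniq M phi m m' : convex_components phi ->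
  feasible M m -> feasible M m' -> balanced phi m' ->
  (forall j k : 'I_n, j != k -> (1 <= m k)%N ->
     H phi k (m k) < H phi j (m j).+1) ->
  m' = m.
Proof.
move=> phi_cvx m_feas m'_feas m'_bal m_strict; apply: contraTeq isT => neq.
have [k lt_k] := exists_lt_feasible m'_feas m_feas neq.
have [j lt_j] : exists j, (m j < m' j)%N.
  by apply: exists_lt_feasible m_feas m'_feas _; rewrite eq_sym.
have jk : j != k by apply: contraTneq lt_j => ->; rewrite -leqNgt ltnW.
have := m_strict j k jk (leq_ltn_trans (leq0n _) lt_k); rewrite ltNge => /negP[].
apply: (le_trans (le_H _ phi_cvx (ltn0Sn _) lt_j)).
apply: (le_trans (m'_bal k j (leq_ltn_trans (leq0n _) lt_j))).
exact: le_H.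
Qed.

End Increments.

Theorem theorem6p2 (R : realType) (n M : nat)
    (phi : 'I_n -> nat -> R) (psi : {ffun 'I_n -> nat} -> R)
    (n_gt0 : (0 < n)%N) (M_gt0 : (0 < M)%N)
    (psiP : decomposable_error M phi psi) :
  [/\ exists m, minimal_solution M psi m,
      forall m0 : {ffun 'I_n -> nat}, feasible M m0 ->
        (minimal_solution M psi m0 <->
         forall j k : 'I_n, (1 <= m0 k)%N ->
           H phi j (m0 j).+1 >= H phi k (m0 k)),
      forall m0 : {ffun 'I_n -> nat}, minimal_solution M psi m0 ->
        (forall j k : 'I_n, j != k -> (1 <= m0 k)%N ->
           H phi j (m0 j).+1 > H phi k (m0 k)) ->
        forall m, minimal_solution M psi m -> m = m0
    & forall m : {ffun 'I_n -> nat},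
        greedy_selection M phi m <-> minimal_solution M psi m].
Proof.
have [_ phi_cvx psiE] := psiP.
have minP m := minimal_solutionP (m := m) M_gt0 psiP.
have min_ex := exists_minimal_solution M psi n_gt0.
split=> // [m0 [m0_feas _] m0_strict m m_min|m].
  apply: (strictly_balanced_uniq phi_cvx m0_feas m_min.1) => //.
  exact/(minP _ m_min.1).
have min_greedy m' : minimal_solution M psi m' -> greedy_selection M phi m'.
  move=> m'_min; apply: balanced_greedy phi_cvx m'_min.1 _.
  exact/(minP _ m'_min.1).
split=> [m_greedy|]; last exact: min_greedy.
(* Some minimal [m'] exists and is itself greedy, so [m] has the same error as [m']. *)
have [m' m'_min] := min_ex; split=> [|m'' m''_feas]; first exact: m_greedy.1.
rewrite (psiE m m_greedy.1) -/(total_error phi m).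
rewrite (greedy_total_error m_greedy (min_greedy _ m'_min)) /total_error.
by rewrite -psiE; [apply: m'_min.2|apply: m'_min.1].
Qed.
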